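(* For any non-negative integers $k,l,m$ with $k+l+m\ge 1$, the Toeplitz graph $G_n(0^k1^l0^m)$ is word-representable for every positive integer $n$.
   Context: For a word $a_1a_2\cdots a_p$ over $\{0,1\}$, the Toeplitz graph $G_n(a_1a_2\cdots a_p)$ is the simple graph on vertex set $[n]=\{1,\dots,n\}$ in which distinct vertices $x,y$ are adjacent if and only if $a_r=1$, where $r\in[p]$ is such that $r\equiv |x-y|\pmod p$. (Equivalently it is the Riordan graph $G_n\big(\frac{a_1+a_2z+\cdots+a_pz^{p-1}}{1-z^p},z\big)$.) For a letter $c$, $c^j$ denotes $c$ repeated $j$ times, so $0^k1^l0^m$ is the word of length $k+l+m$ consisting of $k$ zeros, then $l$ ones, then $m$ zeros. Two distinct letters $x,y$ alternate in a word $w$ if deleting all other letters from $w$ yields a word of the form $xyxy\cdots$ or $yxyx\cdots$ (of even or odd length). A graph $G=(V,E)$ is word-representable if there is a word $w$ over the alphabet $V$ such that for all distinct $x,y\in V$, $x$ and $y$ alternate in $w$ if and only if $xy\in E$. *)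

(* Defs.v *)
From mathcomp Require Import all_boot all_order all_algebra.

Set Implicit Arguments.
Unset Strict Implicit.
Unset Printing Implicit Defensive.

(* The word xyxy... of length s. *)
Definition altword (V : Type) (x y : V) (s : nat) : seq V :=
  mkseq (fun i => if odd i then y else x) s.

Definition alternate (V : eqType) (w : seq V) (x y : V) : Prop :=
  exists s : nat,
    filter (pred2 x y) w = altword x y s \/ filter (pred2 x y) w = altword y x s.

(* A graph on V is given by its adjacency relation E. *)
Definition word_representable (V : finType) (E : rel V) : Prop :=
  exists w : seq V, forall x y : V, x != y -> (alternate w x y <-> E x y).

(* The vertex i of 'I_n stands for i + 1 in [n], which leaves |x - y| unchanged.
   The index r of 'I_p stands for r + 1 in [p]: the letter a_(r+1) is
   nth false a r, with true for 1 and false for 0. *)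
Definition toeplitz_graph (n : nat) (a : seq bool) : rel 'I_n :=
  [rel x y : 'I_n | (x != y) &&
    [exists r : 'I_(size a),
      (r.+1 == `|x - y|%N %[mod size a]) && nth false a r]].

Lemma toeplitz_graph_sym n a : symmetric (@toeplitz_graph n a).
Proof. by move=> x y; rewrite /toeplitz_graph /= eq_sym distnC. Qed.

Lemma toeplitz_graph_irr n a : irreflexive (@toeplitz_graph n a).
Proof. by move=> x; rewrite /toeplitz_graph /= eqxx. Qed.

(* Main.v *)
Require Import Defs.
From mathcomp Require Import all_boot all_order all_algebra.
From mathcomp Require Import zify.

(** Write a vertex as [x = q p + s] with [p = k + l + m] and [0 <= s < p].  Orient
    every edge towards the larger [s] (towards the smaller [q] if the two [s] are
    equal).  Then [u -> v] iff [q_u <= q_v] and [k + 1 <= s_v - s_u <= k + l], or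
    [q_u > q_v] and [m <= s_v - s_u < m + l].  Dropping the two upper bounds gives
    a strict partial order [R], and if [u -> w] and [u R v R w] then [u -> v -> w],
    because whichever of the two steps goes in the direction of [u -> w] already
    uses up the lower bound of that direction.

    An acyclic orientation without such shortcuts yields a representing word
    (Halldorsson, Kitaev, Pyatkin): for each vertex [v] there is a word containing
    every letter twice, restricting to [xyxy] for each edge [x -> y], in which [v]
    alternates with none of its non-neighbours; concatenate these words. *)

Section SemiTransitive.

Variables (V : finType) (E D R : rel V).
Hypothesis R_irr : irreflexive R.
Hypothesis R_trans : transitive R.
Hypothesis subDR : subrel D R.
Hypothesis shortcut_free :
  forall u v w, D u w -> R u v -> R v w -> D u v && D v w.
Hypothesis E_D : forall x y, x != y -> E x y = D x y || D y x.

(** A linear extension of [R], since the number of [R]-predecessors strictly increases along [R]. *)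
Definition topo : seq V := sort (relpre (fun u => #|[pred x | R x u]|) leq) (enum V).

Lemma R_card_lt u v : R u v -> #|[pred x | R x u]| < #|[pred x | R x v]|.
Proof.
move=> Ruv; apply/proper_card/properP; split.
  by apply/subsetP => x; rewrite !inE => Rxu; apply: R_trans Rxu Ruv.
by exists u; rewrite !inE ?R_irr.
Qed.

Lemma topo_filter2 x y : x != y ->
  filter (pred2 x y) topo = [:: x; y] \/ filter (pred2 x y) topo = [:: y; x].
Proof.
move=> nxy.
have : perm_eq (filter (pred2 x y) topo) [:: x; y].
  apply: uniq_perm; rewrite /= ?inE ?nxy ?filter_uniq ?sort_uniq ?enum_uniq //.
  by move=> z; rewrite mem_filter mem_sort mem_enum !inE andbT.
move=> peq; have := perm_size peq; move: peq.
case: (filter _ _) => [|a [|b [|? ?]]] //= peq _.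
have := perm_mem peq x; have := perm_mem peq y; rewrite !inE !eqxx orbT /=.
case/orP => /eqP ey /orP[] /eqP ex; move: nxy; subst; rewrite ?eqxx //.
  by right.
by left.
Qed.

Lemma topo_filter2_R x y : R x y -> filter (pred2 x y) topo = [:: x; y].
Proof.
move=> Rxy; have nxy : x != y by apply: contraTneq Rxy => ->; rewrite R_irr.
have [//|e] := topo_filter2 x y nxy.
have : sorted (relpre (fun u => #|[pred x | R x u]|) leq) (filter (pred2 x y) topo).
  apply: sorted_filter; first by move=> b a c /=; apply: leq_trans.
  by apply: sort_sorted => a b; apply: leq_total.
by rewrite e /= andbT leqNgt R_card_lt.
Qed.

(* 0: non-adjacent ancestor of v, 1: in-neighbour, 2: v itself,
   3: out-neighbour, 4: non-adjacent descendant, 5: incomparable with v. *)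
Definition vclass (v x : V) : nat :=
  if x == v then 2 else if D x v then 1 else if R x v then 0
  else if D v x then 3 else if R v x then 4 else 5.

(* With v the classes 0, 4, 5 give the patterns aavv, vvbb, tvvt, while 1 and 3
   give iviv and vovo. *)
Definition blocks : seq (seq nat) :=
  [:: [:: 0; 1; 5]; [:: 0]; [:: 2]; [:: 3]; [:: 1]; [:: 2]; [:: 4]; [:: 3; 4; 5]].

(** Every letter occurs twice, as each class lies in exactly two blocks. *)
Definition vword (v : V) : seq V :=
  flatten [seq [seq x <- topo | vclass v x \in B] | B <- blocks].

Lemma filter_vword v x y :
  filter (pred2 x y) (vword v) =
  flatten [seq [seq z <- filter (pred2 x y) topo | vclass v z \in B] | B <- blocks].
Proof.
rewrite /vword filter_flatten -map_comp; congr flatten.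
by apply: eq_map => B /=; rewrite -!filter_predI; apply: eq_filter => z /=; rewrite andbC.
Qed.

Lemma vword_edge v x y : D x y -> filter (pred2 x y) (vword v) = [:: x; y; x; y].
Proof.
move=> Dxy; have Rxy := subDR _ _ Dxy.
rewrite filter_vword topo_filter2_R //= /vclass.
have RN a b : R a b ==> ~~ R b a.
  by apply/implyP => Rab; apply/negP => /(R_trans _ _ _ Rab); rewrite R_irr.
have DR a b : D a b ==> R a b by apply/implyP/subDR.
case: (eqVneq x v) => [ex|_]; [subst x|]; case: (eqVneq y v) => [ey|_] //=.
- move: (DR y v) (RN v y); rewrite Rxy Dxy.
  by case: (R y v); rewrite // implybF => /negbTE->.
- by subst y; rewrite Dxy.
(* For [v] distinct from [x] and [y], shortcut-freeness excludes the class pairs (1,0) and (4,3),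
   and leaves only (1,3) when [v] lies between [x] and [y] in [R]. *)
have RxvP : R y v ==> R x v by apply/implyP/R_trans.
have RvyP : R v x ==> R v y by apply/implyP => /R_trans; apply.
have DyvP : D x v && R y v ==> D y v.
  by apply/implyP => /andP[Dxv /(shortcut_free _ _ _ Dxv Rxy) /andP[]].
have DvxP : D v y && R v x ==> D v x.
  by apply/implyP => /andP[Dvy /(shortcut_free _ _ _ Dvy) /(_ Rxy) /andP[]].
have DxvyP : R x v && R v y ==> D x v && D v y.
  by apply/implyP => /andP[Rxv /(shortcut_free _ _ _ Dxy Rxv)].
move: (RN x v) (RN y v) (DR x v) (DR y v) (DR v x) (DR v y).
move: RxvP RvyP DyvP DvxP DxvyP; clear.
by case: (R x v); case: (R v x); case: (R y v); case: (R v y) => //;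
   case: (D x v); case: (D v x); case: (D y v); case: (D v y).
Qed.

Lemma vword_nonedge v x :
  v != x -> ~~ D v x -> ~~ D x v ->
  ~~ sorted (fun a b => a != b) (filter (pred2 v x) (vword v)).
Proof.
move=> nvx nDvx nDxv; rewrite filter_vword.
have nxv : (x == v) = false by rewrite eq_sym (negbTE nvx).
have clsv : vclass v v = 2 by rewrite /vclass eqxx.
have clsx : vclass v x \in [:: 0; 4; 5].
  by rewrite /vclass nxv (negbTE nDvx) (negbTE nDxv); case: (R x v); case: (R v x).
move: clsx; rewrite !inE.
have [->|->] := topo_filter2 v x nvx; rewrite /= !clsv.
all: by case/or3P => /eqP-> /=; rewrite eqxx ?andbF.
Qed.

Lemma altword_sorted (x y : V) s : x != y -> sorted (fun a b => a != b) (altword x y s).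
Proof.
move=> nxy; apply/(sortedP x) => i; rewrite size_mkseq => lis.
by rewrite !nth_mkseq //=; last exact: ltnW; case: (odd i); rewrite //= eq_sym.
Qed.

Lemma altword_flatten (x y : V) c :
  flatten (nseq c [:: x; y; x; y]) = altword x y (4 * c).
Proof.
elim: c => //= c ->; rewrite mulnS /altword /mkseq iotaD map_cat /= /altword /mkseq.
rewrite (iotaDl 4 0) -map_comp; do 4!congr cons.
by apply: eq_map => i; rewrite /= !negbK.
Qed.

Theorem semi_transitive_word_representable : word_representable E.
Proof.
exists (flatten [seq vword v | v <- enum V]) => x y nxy; rewrite E_D //.
have altD u v : D u v -> filter (pred2 u v) (flatten [seq vword v | v <- enum V]) =
                altword u v (4 * #|V|).
  move=> Duv; rewrite filter_flatten -map_comp -altword_flatten cardE; congr flatten.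
  by elim: (enum V) => //= z t ->; rewrite vword_edge.
split; last first.
  case/orP => [Dxy|Dyx]; exists (4 * #|V|); [left|right]; first exact: altD.
  by rewrite -altD //; apply: eq_filter => z /=; rewrite orbC.
case=> s alt; apply: contraT; rewrite negb_or => /andP[nDxy nDyx].
have : sorted (fun a b => a != b)
    (filter (pred2 x y) (flatten [seq vword v | v <- enum V])).
  by case: alt => ->; apply: altword_sorted; rewrite // eq_sym.
(* Having no two equal adjacent letters passes to factors, and the factor [vword x] violates it for
   the non-neighbour [y]. *)
have /splitPr[s1 s2] : x \in enum V by rewrite mem_enum.
rewrite map_cat flatten_cat filter_cat => /cat_sorted2[_].
rewrite /= filter_cat => /cat_sorted2[+ _].
by move=> srt; case/negP: (vword_nonedge _ _ nxy nDxy nDyx).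
Qed.

End SemiTransitive.

Section ToeplitzOrientation.

Variables k l m : nat.
Let p := k + l + m.

(** If the quotient drops from [u] to [v], the distance is congruent to [p] minus the residue gap,
    so distances [k + 1] to [k + l] become gaps [m] to [m + l - 1]: hence one strict and one weak
    lower bound. *)
Definition toeplitz_before (u v : nat) : bool :=
  if u %/ p <= v %/ p then u %% p + k < v %% p else u %% p + m <= v %% p.

Definition toeplitz_arc (u v : nat) : bool :=
  toeplitz_before u v &&
  if u %/ p <= v %/ p then v %% p <= u %% p + k + l else v %% p < u %% p + m + l.

Lemma toeplitz_before_irr : irreflexive toeplitz_before.
Proof. by move=> u; rewrite /toeplitz_before leqnn; lia. Qed.

Lemma toeplitz_before_trans : transitive toeplitz_before.
Proof.
move=> v u w; rewrite /toeplitz_before.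
by do 3 case: ifP; lia.
Qed.

(** The step in the direction of [u -> w] leaves a residue gap of at most [l - 1] to the other step,
    which is within both upper bounds. *)
Lemma toeplitz_arc_shortcut_free u v w :
  toeplitz_arc u w -> toeplitz_before u v -> toeplitz_before v w ->
  toeplitz_arc u v && toeplitz_arc v w.
Proof.
rewrite /toeplitz_arc /toeplitz_before.
by do 3 case: ifP; lia.
Qed.

Lemma nth_nseq_false_true_false r : nth false (nseq k false ++ nseq l true ++ nseq m false) r =
  (k <= r < k + l).
Proof.
rewrite !nth_cat !nth_nseq !size_nseq.
by do ?case: ifP; lia.
Qed.

Lemma toeplitz_graph_arc n (x y : 'I_n) : 0 < p -> x != y ->
  toeplitz_graph (nseq k false ++ nseq l true ++ nseq m false) x y =
  toeplitz_arc x y || toeplitz_arc y x.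
Proof.
move=> p_gt0; set a := _ ++ _.
wlog ltxy : x y / x < y => [hw nxy|_].
  have [/hw-> //|ltyx|/val_inj e] := ltngtP x y; last by rewrite e eqxx in nxy.
  by rewrite toeplitz_graph_sym hw 1?orbC // eq_sym.
have sza : size a = p by rewrite !size_cat !size_nseq addnA.
have nxy : x != y by apply: contraTneq ltxy => ->; rewrite ltnn.
(* The representative in [[p]] of a distance [d] is [(d - 1) %% p + 1], so its 0-based index is
   [(d - 1) %% p]. *)
have -> : toeplitz_graph a x y = (k <= (y - x).-1 %% p < k + l).
  rewrite /toeplitz_graph /= nxy (distnEr (ltnW ltxy)) /=.
  have d_eq : (y - x).-1.+1 = y - x by rewrite prednK // subn_gt0.
  apply/idP/idP => [/existsP[[r ltr]]|rP]; last apply/existsP.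
    rewrite nth_nseq_false_true_false /=; move: ltr; rewrite sza => ltr.
    rewrite -{1}d_eq -addn1 -[X in _ == X %[mod _]]addn1 eqn_modDr.
    by rewrite (modn_small ltr) addn1 => /andP[/eqP <-].
  have ltr : (y - x).-1 %% p < size a by rewrite sza ltn_mod.
  exists (Ordinal ltr); rewrite nth_nseq_false_true_false rP andbT /= sza.
  by rewrite -[X in _ == X %[mod _]]d_eq -addn1 -[X in _ == X %[mod _]]addn1 eqn_modDr modn_mod.
have lsx := ltn_pmod x p_gt0; have lsy := ltn_pmod y p_gt0.
have leq_q : x %/ p <= y %/ p by apply: leq_div2r; apply: ltnW.
have -> : (y - x).-1 %% p =
    if x %% p < y %% p then (y %% p - x %% p).-1 else (y %% p + p - x %% p).-1.
  have ex := divn_eq x p; have ey := divn_eq y p.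
  case: ifP => lts.
    have -> : (y - x).-1 = (y %/ p - x %/ p) * p + (y %% p - x %% p).-1.
      by have := leq_mul leq_q (leqnn p); rewrite mulnBl; lia.
    by rewrite modnMDl modn_small //; lia.
  have lt_q : x %/ p < y %/ p.
    by rewrite ltn_neqAle leq_q andbT; apply: contraTneq ltxy => eq_q; lia.
  have -> : (y - x).-1 = (y %/ p - (x %/ p).+1) * p + (y %% p + p - x %% p).-1.
    by have := leq_mul lt_q (leqnn p); rewrite mulnBl mulSn; lia.
  by rewrite modnMDl modn_small //; lia.
rewrite /toeplitz_arc /toeplitz_before leq_q.
(* Equal quotients order the residues as [x < y], which rules out an arc from [y] to [x]. *)
have qs : y %/ p <= x %/ p -> x %% p < y %% p.
  move=> geq_q; have eq_q : x %/ p = y %/ p by apply/eqP; rewrite eqn_leq leq_q.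
  by have := divn_eq x p; have := divn_eq y p; rewrite eq_q; lia.
move: qs; case: (y %/ p <= x %/ p) => [/(_ isT)|_]; case: ifP; lia.
Qed.

End ToeplitzOrientation.

Theorem theorem4 (k l m : nat) (hklm : 1 <= k + l + m) (n : nat) (hn : 0 < n) :
  word_representable
    (@toeplitz_graph n (nseq k false ++ nseq l true ++ nseq m false)).
Proof.
apply: (@semi_transitive_word_representable 'I_n _
  (fun x y => toeplitz_arc k l m x y) (fun x y => toeplitz_before k l m x y)).
- by move=> x; apply: toeplitz_before_irr.
- by move=> y x z; apply: toeplitz_before_trans.
- by move=> x y /andP[].
- by move=> u v w; apply: toeplitz_arc_shortcut_free.
- by move=> x y; apply: toeplitz_graph_arc.
Qed.
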